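(* Let $\mathcal{F}$ be an $n$-periodic tame frieze with quiddity sequence $q$ of length $n$ ($n\ge1$, not necessarily the minimal period), let $\mathcal{L}=(m_{i,j})_{i,j\in\mathbb{Z}}$ be its lattice, and put $s_q:=m_{1,n}-m_{2,n-1}$. Then for all $i,j\in\mathbb{Z}$: (i) $m_{i,j+2n}=s_q\,m_{i,j+n}-m_{i,j}$; (ii) $m_{i-2n,j}=s_q\,m_{i-n,j}-m_{i,j}$.
   Context: A frieze is an array $\mathcal{F}=(m_{i,j})$ of real numbers, with $i\in\mathbb{Z}$, whose rows are the sets of positions with $j-i$ constant, such that $m_{i,i-2}=0$ and $m_{i,i-1}=1$ for all $i$, and such that $m_{i,j}m_{i+1,j+1}-m_{i,j+1}m_{i+1,j}=1$ whenever all four entries lie in the array. It is infinite if it is indexed by all $(i,j)$ with $j-i\ge -2$; it is finite if it is indexed by all $(i,j)$ with $-2\le j-i\le N-2$ for some integer $N\ge 3$ and ends with a row of ones followed by a row of zeros: $m_{i,i+N-3}=1$ and $m_{i,i+N-2}=0$ for all $i$. The quiddity row is $(a_i)_{i\in\mathbb{Z}}$ with $a_i=m_{i,i}$. The frieze is tame if every $3\times 3$ matrix $\begin{pmatrix} m_{i,j}&m_{i+1,j}&m_{i+2,j}\\ m_{i,j+1}&m_{i+1,j+1}&m_{i+2,j+1}\\ m_{i,j+2}&m_{i+1,j+2}&m_{i+2,j+2}\end{pmatrix}$ of entries of the array has determinant $0$. It is $n$-periodic if $m_{i+n,j+n}=m_{i,j}$ for all entries; then $q=(a_1,\dots,a_n)$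 is a quiddity sequence of length $n$ for $\mathcal{F}$. The lattice $\mathcal{L}=(m_{i,j})_{i,j\in\mathbb{Z}}$ of $\mathcal{F}$ is the extension of $\mathcal{F}$ to all of $\mathbb{Z}^2$ by anti-symmetric mirroring across rows of zeros: if $\mathcal{F}$ is infinite, $m_{i,j}=-m_{j+2,i-2}$ for $j-i<-2$; if $\mathcal{F}$ is finite, $\mathcal{L}$ is the unique extension satisfying $m_{i,j}=-m_{j+2,i-2}$ and $m_{i,j}=-m_{j-N+2,i+N-2}$ for all $i,j\in\mathbb{Z}$. *)

(* Defs.v *)
From mathcomp Require Import all_boot all_order all_algebra.
From mathcomp Require Import reals zify.
Set Implicit Arguments.
Unset Strict Implicit.
Unset Printing Implicit Defensive.
Import Order.TTheory GRing.Theory Num.Theory.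
Local Open Scope ring_scope.

Inductive frieze_shape := InfiniteFrieze | FiniteFrieze of nat.

Definition in_array (s : frieze_shape) (i j : int) : bool :=
  match s with
  | InfiniteFrieze => - 2 <= j - i
  | FiniteFrieze N => (- 2 <= j - i) && (j - i <= N%:Z - 2)
  end.

(* An array of shape [s] is a total function [m : int -> int -> R] of which
   only the values at positions in [in_array s] are meaningful. *)
Definition is_frieze (R : realType) (s : frieze_shape) (m : int -> int -> R) :=
  [/\ forall i, m i (i - 2) = 0,
      forall i, m i (i - 1) = 1,
      forall i j,
        in_array s i j -> in_array s (i + 1) (j + 1) ->
        in_array s i (j + 1) -> in_array s (i + 1) j ->
        m i j * m (i + 1) (j + 1) - m i (j + 1) * m (i + 1) j = 1
    & match s with
      | InfiniteFrieze => True
      | FiniteFrieze N =>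
          [/\ (3 <= N)%N,
              forall i, m i (i + N%:Z - 3) = 1
            & forall i, m i (i + N%:Z - 2) = 0]
      end].

Definition tame (R : realType) (s : frieze_shape) (m : int -> int -> R) :=
  forall i j : int,
    (forall k l : 'I_3, in_array s (i + l%:Z) (j + k%:Z)) ->
    \det (\matrix_(k < 3, l < 3) m (i + l%:Z) (j + k%:Z)) = 0.

Definition periodic (R : realType) (s : frieze_shape) (n : nat)
    (m : int -> int -> R) :=
  forall i j : int, in_array s i j -> m (i + n%:Z) (j + n%:Z) = m i j.

(* [q] lists the quiddity entries a_1, ..., a_n; tuples are indexed from 0. *)
Definition quiddity_sequence (R : realType) (n : nat)
    (m : int -> int -> R) (q : n.-tuple R) :=
  forall k : 'I_n, tnth q k = m k.+1%:Z k.+1%:Z.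

Definition is_lattice (R : realType) (s : frieze_shape)
    (m L : int -> int -> R) :=
  (forall i j : int, in_array s i j -> L i j = m i j) /\
  match s with
  | InfiniteFrieze =>
      forall i j : int, j - i < - 2 -> L i j = - L (j + 2) (i - 2)
  | FiniteFrieze N =>
      (forall i j : int, L i j = - L (j + 2) (i - 2)) /\
      (forall i j : int, L i j = - L (j - N%:Z + 2) (i + N%:Z - 2))
  end.

Lemma lattice_exists (R : realType) (s : frieze_shape) (m : int -> int -> R) :
  is_frieze s m -> exists L, is_lattice s m L.
Proof.
case: s => [|N] [m0 _ _] => [_|[N3 _ mN]].
  exists (fun i j => if - 2 <= j - i then m i j else - m (j + 2) (i - 2)).
  split=> i j /= hij; first by rewrite hij.
  have -> : (- 2 <= j - i) = false by lia.
  by have -> : - 2 <= i - 2 - (j + 2) by lia.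
pose t (i j : int) := ((j - i + 2) %/ (2 * N%:Z))%Z * N%:Z.
pose M (i j : int) := if j - i <= N%:Z - 2 then m i j
                      else - m (j - N%:Z + 2) (i + N%:Z - 2).
exists (fun i j => M (i + t i j) (j - t i j)).
have tE i j : 0 <= j - i + 2 - 2 * t i j < 2 * N%:Z.
  rewrite /t; have N0 : 2 * N%:Z != 0 :> int by lia.
  have := divz_eq (j - i + 2) (2 * N%:Z); have := modz_ge0 (j - i + 2) N0.
  have := ltz_mod (j - i + 2) N0; lia.
have tU i j k : 0 <= j - i + 2 - 2 * (k * N%:Z) < 2 * N%:Z -> t i j = k * N%:Z.
  move=> h; have := tE i j; rewrite /t; set k' := (_ %/ _)%Z => h'.
  by suff -> : k' = k by []; nia.
split=> [i j /= hij|].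
  rewrite (tU i j 0) ?mul0r ?addr0 ?subr0 /M; last lia.
  by rewrite ifT //; lia.
have eqm (i j i' j' : int) : i = i' -> j = j' -> m i j = m i' j' by move=> -> ->.
have z0 (i j : int) : j = i - 2 -> m i j = 0 by move=> ->.
have zN (i j : int) : j = i + N%:Z - 2 -> m i j = 0 by move=> ->.
split=> i j.
  have := tE i j; have [k tk] : exists k, t i j = k * N%:Z by eexists.
  rewrite tk => h; have [h0|h0] := eqVneq (j - i + 2) (2 * (k * N%:Z)).
    rewrite (tU (j + 2) (i - 2) (- k)) /M; last lia.
    by rewrite !ifT ?z0 ?oppr0 //; lia.
  rewrite (tU (j + 2) (i - 2) (- k - 1)) /M; last lia.
  case: ifP => h1; case: ifP => h2; rewrite ?opprK;
    first [lia | by apply: eqm; lia | by congr (- _); apply: eqm; lia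
          | by rewrite !zN ?oppr0 //; lia].
have := tE i j; have [k tk] : exists k, t i j = k * N%:Z by eexists.
rewrite tk => h; have [h0|h0] := eqVneq (j - i + 2) (2 * (k * N%:Z)).
  rewrite (tU (j - N%:Z + 2) (i + N%:Z - 2) (- k + 1)) /M; last lia.
  by rewrite !ifT ?z0 ?oppr0 //; lia.
rewrite (tU (j - N%:Z + 2) (i + N%:Z - 2) (- k)) /M; last lia.
case: ifP => h1; case: ifP => h2; rewrite ?opprK;
  first [lia | by apply: eqm; lia | by congr (- _); apply: eqm; lia
        | by rewrite !zN ?oppr0 //; lia].
Qed.

(* Main.v *)
Require Import Defs.
From mathcomp Require Import all_boot all_order all_algebra.
From mathcomp Require Import reals.
From mathcomp Require Import zify ring.
Import Order.TTheory GRing.Theory Num.Theory.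
Local Open Scope ring_scope.

Set Implicit Arguments.
Unset Strict Implicit.

(* Tameness forces every row of the lattice [L] to solve the second order
   linear recurrence [h j = a_j h (j - 1) - h (j - 2)] with [n]-periodic
   coefficients [a].  Translation by [n] acts on the two-dimensional space of
   solutions with determinant 1 (constancy of the Casoratian) and, in the basis
   [L 1 _], [L 2 _], with trace [L 1 n - L 2 (n - 1)]; the first identity is
   Cayley-Hamilton for this operator, and the second follows from the first by
   the antisymmetry [L i j = - L (j + 2) (i - 2)]. *)

(** * Two-sided second order linear recurrences and their monodromy *)

Lemma int_double_ind (P : int -> Prop) (k : int) :
  P k -> P (k + 1) ->
  (forall j, P j -> P (j + 1) -> P (j + 2) /\ P (j - 1)) ->
  forall j, P j.
Proof.
move=> P0 P1 PS.
have up (d : nat) : P (k + d%:Z) /\ P (k + d%:Z + 1).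
  elim: d => [|d [IH1 IH2]]; first by rewrite addr0.
  have -> : k + d.+1%:Z = k + d%:Z + 1 by lia.
  by split=> //; rewrite -addrA; case: (PS _ IH1 IH2).
have dn (d : nat) : P (k - d%:Z) /\ P (k - d%:Z + 1).
  elim: d => [|d [IH1 IH2]]; first by rewrite subr0.
  have -> : k - d.+1%:Z = k - d%:Z - 1 by lia.
  by rewrite subrK; split=> //; case: (PS _ IH1 IH2).
move=> j; have [kj|jk] := lerP k j.
  have [d ->] : exists d : nat, j = k + d%:Z by exists `|j - k|%N; lia.
  by case: (up d).
have [d ->] : exists d : nat, j = k - d%:Z by exists `|j - k|%N; lia.
by case: (dn d).
Qed.

Definition solves_rec (R : pzRingType) (a h : int -> R) :=
  forall j, h j = a j * h (j - 1) - h (j - 2).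

Section SecondOrderRecurrence.
Variables (R : comPzRingType) (a : int -> R).

(** The coefficient of [h (j - 2)] is the unit -1, so two adjacent values propagate backward as well
    as forward. *)
Lemma solves_rec_eq0 (h : int -> R) (k : int) : solves_rec a h ->
  h k = 0 -> h (k + 1) = 0 -> forall j, h j = 0.
Proof.
move=> hrec h0 h1; apply: (int_double_ind (P := fun j => h j = 0) (k := k)) => // j hj hj1.
split.
  have := hrec (j + 2); have -> : j + 2 - 1 = j + 1 by lia.
  by rewrite addrK hj hj1 mulr0 subr0.
have := hrec (j + 1); have -> : j + 1 - 2 = j - 1 by lia.
by rewrite addrK hj hj1 mulr0 sub0r => /esym/eqP; rewrite oppr_eq0 => /eqP.
Qed.

Lemma solves_rec_eq (h h' : int -> R) (k : int) :
  solves_rec a h -> solves_rec a h' ->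
  h k = h' k -> h (k + 1) = h' (k + 1) -> h =1 h'.
Proof.
move=> hrec hrec' e0 e1 j; apply/eqP; rewrite -subr_eq0; apply/eqP.
apply: (solves_rec_eq0 (h := fun j => h j - h' j) (k := k)); rewrite ?e0 ?e1 ?subrr //.
by move=> l /=; rewrite hrec (hrec' l); ring.
Qed.

Lemma solves_rec_shift (p : int) (h : int -> R) :
  (forall j, a (j + p) = a j) -> solves_rec a h ->
  solves_rec a (fun j => h (j + p)).
Proof.
move=> aper hrec j /=; rewrite hrec aper.
by have -> : j + p - 1 = j - 1 + p by [lia]; have -> : j + p - 2 = j - 2 + p by lia.
Qed.

Lemma solves_rec_lin (u v : R) (f g : int -> R) :
  solves_rec a f -> solves_rec a g -> solves_rec a (fun j => u * f j + v * g j).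
Proof. by move=> hf hg j /=; rewrite hf (hg j); ring. Qed.

Variables f g : int -> R.
Hypotheses (hf : solves_rec a f) (hg : solves_rec a g).

(** The companion matrix of the recurrence has determinant 1. *)
Lemma casoratian_const (k j : int) :
  f (j - 1) * g j - f j * g (j - 1) = f (k - 1) * g k - f k * g (k - 1).
Proof.
pose W j := f (j - 1) * g j - f j * g (j - 1).
have WS l : W (l + 1) = W l.
  rewrite /W (hf (l + 1)) (hg (l + 1)) addrK.
  by have -> : l + 1 - 2 = l - 1 by [lia]; ring.
suff: W j = W k by [].
apply: (int_double_ind (P := fun j => W j = W k) (k := k)) => // l wl _.
have -> : l + 2 = l + 1 + 1 by lia.
by rewrite !WS; split=> //; rewrite -(WS (l - 1)) subrK.
Qed.

(** These are the values of [L 1] and [L 2] at -1 and 0. *)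
Hypotheses (f0 : f 0 = 1) (f1 : f (-1) = 0) (g0 : g 0 = 0) (g1 : g (-1) = -1).

Lemma solves_rec_basis (h : int -> R) : solves_rec a h ->
  forall j, h j = h 0 * f j + - h (- 1) * g j.
Proof.
move=> hh; apply: (solves_rec_eq (k := -1) hh).
- exact: solves_rec_lin.
- by rewrite f1 g1; ring.
- by rewrite addNr f0 g0; ring.
Qed.

Lemma solves_rec_monodromy (p : int) (h : int -> R) :
  (forall j, a (j + p) = a j) -> solves_rec a h ->
  forall j, h (j + 2 * p) = (f p - g (p - 1)) * h (j + p) - h j.
Proof.
move=> aper hh.
have shE h' : solves_rec a h' ->
    forall j, h' (j + p) = h' p * f j + - h' (p - 1) * g j.
  move=> hh' j; rewrite (solves_rec_basis (solves_rec_shift aper hh') j).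
  by rewrite add0r [-1 + p]addrC.
have W : f (p - 1) * g p - f p * g (p - 1) = 1.
  by rewrite (casoratian_const 0 p) sub0r f0 f1 g0 g1; ring.
(* On the basis, the coefficients given by [shE] are the entries of the monodromy matrix itself. *)
have CH h' : solves_rec a h' -> h' = f \/ h' = g ->
    forall j, h' (j + 2 * p) = (f p - g (p - 1)) * h' (j + p) - h' j.
  move=> hh' h'E j; have -> : j + 2 * p = j + p + p by lia.
  (* Replacing the coefficient 1 by the determinant [W] leaves a polynomial identity. *)
  rewrite -[X in _ - X]mul1r -W (shE h' hh') (shE f hf j) (shE g hg j).
  by case: h'E => ->; rewrite ?(shE f hf j) ?(shE g hg j); ring.
move=> j; rewrite (solves_rec_basis hh (j + 2 * p)) (solves_rec_basis hh (j + p)).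
rewrite (solves_rec_basis hh j).
by rewrite (CH f hf (or_introl erefl)) (CH g hg (or_intror erefl)); ring.
Qed.

End SecondOrderRecurrence.

(** * Quiddity recurrences in both indices of a tame frieze *)

Lemma in_array_sub (s : frieze_shape) (i j i' j' : int) :
  in_array s i j -> - 2 <= j' - i' <= j - i -> in_array s i' j'.
Proof. by rewrite /in_array; case: s => [|N]; lia. Qed.

Lemma det3E (R : comNzRingType) (F : nat -> nat -> R) :
  \det (\matrix_(k < 3, l < 3) F k l) =
    F 0 0 * (F 1 1 * F 2 2 - F 1 2 * F 2 1)
  - F 0 1 * (F 1 0 * F 2 2 - F 1 2 * F 2 0)
  + F 0 2 * (F 1 0 * F 2 1 - F 1 1 * F 2 0).
Proof.
rewrite (expand_det_row _ ord0) !big_ord_recl big_ord0 /cofactor.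
rewrite !(expand_det_row _ ord0) !big_ord_recl !big_ord0 /cofactor.
rewrite !det_mx11 !mxE /= /bump /=; ring.
Qed.

Section Frieze.
Variables (R : realType) (s : frieze_shape) (m : int -> int -> R).
Hypotheses (hfrieze : is_frieze s m) (htame : tame s m).

Let a (i : int) := m i i.

Lemma in_array_diag (i : int) : in_array s i i.
Proof. by case: hfrieze; case: (s) => [|N] _ _ _ /=; [|case]; lia. Qed.

Lemma frieze_unimodular (i j : int) : in_array s i (j + 1) -> - 1 <= j - i ->
  m i j * m (i + 1) (j + 1) - m i (j + 1) * m (i + 1) j = 1.
Proof.
by move=> hij h; case: hfrieze => _ _ /(_ i j) + _; apply;
  apply: (in_array_sub hij); lia.
Qed.

Lemma tame_expanded (i j : int) : 0 <= j - i -> in_array s i (j + 2) ->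
    m i j * (m (i + 1) (j + 1) * m (i + 2) (j + 2)
           - m (i + 2) (j + 1) * m (i + 1) (j + 2))
  - m (i + 1) j * (m i (j + 1) * m (i + 2) (j + 2)
           - m (i + 2) (j + 1) * m i (j + 2))
  + m (i + 2) j * (m i (j + 1) * m (i + 1) (j + 2)
           - m (i + 1) (j + 1) * m i (j + 2)) = 0.
Proof.
move=> h hij; have := @htame i j.
rewrite (det3E (fun k l => m (i + l%:Z) (j + k%:Z))) !addr0; apply=> k l.
by apply: (in_array_sub hij); have := ltn_ord k; have := ltn_ord l; lia.
Qed.

Lemma frieze0 (i j : int) : j = i - 2 -> m i j = 0.
Proof. by move=> ->; case: hfrieze. Qed.

Lemma frieze1 (i j : int) : j = i - 1 -> m i j = 1.
Proof. by move=> ->; case: hfrieze. Qed.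

(** The border entries 1 and 0 stay visible, so that this is the base case for both indices. *)
Lemma frieze_rec_diag (i : int) : m i i = a i * 1 - 0.
Proof. by rewrite mulr1 subr0. Qed.

Lemma frieze_rec_superdiag (i : int) : in_array s i (i + 1) ->
  m i (i + 1) = a i * a (i + 1) - 1.
Proof.
move=> hij; have := frieze_unimodular hij.
by rewrite (@frieze1 (i + 1) i) /a; [move=> <-; [ring | lia] | lia].
Qed.

(* In the determinant expansion, the relations already known for columns
   [i + 1] and [i + 2] reduce the last row to one entry, whose cofactor is 1. *)
Lemma frieze_rec_right (i j : int) : 0 <= j - i -> in_array s i j ->
  m i j = a j * m i (j - 1) - m i (j - 2).
Proof.
have [d] : exists d : nat, (`|j - i| <= d)%N by exists `|j - i|%N.
elim: d i j => [|d IH] i j hd h hij.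
  have -> : j = i by lia.
  by rewrite frieze_rec_diag frieze1 ?frieze0.
have [->|nji] := eqVneq j i; first by rewrite frieze_rec_diag frieze1 ?frieze0.
(* For [j - i < 2] the 3x3 block with extreme entry [m i j] would reach below the row of zeros,
   hence the separate cases. *)
have [ji|nji1] := eqVneq j (i + 1).
  rewrite ji in hij *; rewrite (frieze_rec_superdiag hij) addrK.
  by rewrite (@frieze1 i (i + 1 - 2)) ?[a i * _]mulrC //; lia.
have hij' : in_array s i (j - 2 + 2) by rewrite subrK.
have E := @tame_expanded i (j - 2) ltac:(lia) hij'.
have U := @frieze_unimodular (i + 1) (j - 2)
  ltac:(apply: (in_array_sub hij); lia) ltac:(lia).
have e1 : j - 2 + 1 = j - 1 by lia.
have e2 : i + 1 + 1 = i + 2 by lia.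
rewrite subrK e1 in E; rewrite e1 e2 in U.
have R1 := IH (i + 1) j
  ltac:(lia) ltac:(lia) ltac:(apply: (in_array_sub hij); lia).
have R2 := IH (i + 2) j
  ltac:(lia) ltac:(lia) ltac:(apply: (in_array_sub hij); lia).
rewrite R1 R2 in E.
apply/eqP; rewrite -subr_eq0 -[X in X == 0]mulr1 -U; apply/eqP.
by rewrite -[RHS]E; ring.
Qed.

(** Here the relations at second indices [j - 1] and [j - 2] reduce the first column of the
    determinant to one entry, again with cofactor 1. *)
Lemma frieze_rec_left (i j : int) : 0 <= j - i -> in_array s i j ->
  m i j = a i * m (i + 1) j - m (i + 2) j.
Proof.
have [d] : exists d : nat, (`|j - i| <= d)%N by exists `|j - i|%N.
elim: d i j => [|d IH] i j hd h hij.
  have -> : j = i by lia.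
  by rewrite frieze_rec_diag frieze1 ?frieze0 //; lia.
have [->|nji] := eqVneq j i.
  by rewrite frieze_rec_diag frieze1 ?frieze0 //; lia.
have [ji|nji1] := eqVneq j (i + 1).
  rewrite ji in hij *; rewrite (frieze_rec_superdiag hij).
  by rewrite (@frieze1 (i + 2) (i + 1)) //; lia.
have hij' : in_array s i (j - 2 + 2) by rewrite subrK.
have E := @tame_expanded i (j - 2) ltac:(lia) hij'.
have U := @frieze_unimodular (i + 1) (j - 2)
  ltac:(apply: (in_array_sub hij); lia) ltac:(lia).
have e1 : j - 2 + 1 = j - 1 by lia.
have e2 : i + 1 + 1 = i + 2 by lia.
rewrite subrK e1 in E; rewrite e1 e2 in U.
have R1 := IH i (j - 1)
  ltac:(lia) ltac:(lia) ltac:(apply: (in_array_sub hij); lia).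
have R2 := IH i (j - 2)
  ltac:(lia) ltac:(lia) ltac:(apply: (in_array_sub hij); lia).
rewrite R1 R2 in E.
apply/eqP; rewrite -subr_eq0 -[X in X == 0]mulr1 -U; apply/eqP.
by rewrite -[RHS]E; ring.
Qed.

(** * Extension of the recurrence to the whole lattice *)

Variable L : int -> int -> R.
Hypothesis hL : is_lattice s m L.

Lemma lattice_array (i j : int) : in_array s i j -> L i j = m i j.
Proof. by case: hL => + _; apply. Qed.

Lemma lattice_zero (i : int) : L i (i - 2) = 0.
Proof.
rewrite lattice_array; first by case: hfrieze.
by apply: (in_array_sub (in_array_diag i)); lia.
Qed.

Lemma lattice_one (i : int) : L i (i - 1) = 1.
Proof.
rewrite lattice_array; first by case: hfrieze.
by apply: (in_array_sub (in_array_diag i)); lia.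
Qed.

Lemma lattice_antisym (i j : int) : L i j = - L (j + 2) (i - 2).
Proof.
case: (hL) => _; case: (s) => [anti|N [anti _]] //.
(* In the infinite case the mirror rule is given on one side only; the other side is the same rule
   read from the mirrored position. *)
have [lt|gt|e] := ltrgtP (j - i) (-2); first exact: anti.
  rewrite (anti (j + 2) (i - 2)); last by lia.
  by rewrite subrK addrK opprK.
have -> : j = i - 2 by lia.
by rewrite subrK lattice_zero oppr0.
Qed.

(* The mirror across the zero row of a finite frieze turns column relations
   into row relations with coefficient index shifted by [N]. *)
Lemma finite_quiddity_periodic (N : nat) (i : int) :
  s = FiniteFrieze N -> a (i + N%:Z) = a i.
Proof.
move=> sE; case: (hfrieze) => _ _ _; rewrite sE => -[N3 mN1 mN0].
have arr (i' j' : int) : 0 <= j' - i' <= N%:Z - 2 -> in_array s i' j'.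
  by rewrite sE /=; lia.
have last1 (i' j' : int) : j' = i' + N%:Z - 3 -> m i' j' = 1 by move=> ->.
have last0 (i' j' : int) : j' = i' + N%:Z - 2 -> m i' j' = 0 by move=> ->.
have A := @frieze_rec_right (i + 2) (i + N%:Z) ltac:(lia) ltac:(apply: arr; lia).
have B := @frieze_rec_left i (i + N%:Z - 2) ltac:(lia) ltac:(apply: arr; lia).
rewrite (last0 (i + 2) (i + N%:Z)) ?(last1 (i + 2) (i + N%:Z - 1)) ?mulr1
  in A; try lia.
rewrite (last0 i (i + N%:Z - 2)) ?(last1 (i + 1) (i + N%:Z - 2)) ?mulr1
  in B; try lia.
by rewrite (subr0_eq (esym A)) (subr0_eq (esym B)).
Qed.

(** Composing the mirrors across two rows of zeros gives a translation, and the two signs cancel. *)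
Lemma finite_lattice_shift (N : nat) (i j : int) :
  s = FiniteFrieze N -> L (i - N%:Z) (j + N%:Z) = L i j.
Proof.
move=> sE; case: (hL) => _; rewrite sE => -[_ anti].
rewrite (lattice_antisym i j) (anti (j + 2)) opprK.
by congr (L _ _); lia.
Qed.

Lemma lattice_rec_near (i j : int) :
    (-1 <= j - i -> in_array s i j) ->
    (j - i <= -2 -> in_array s j (i - 2)) ->
  L i j = a j * L i (j - 1) - L i (j - 2).
Proof.
move=> hij hji; have [e|ne] := eqVneq j (i - 1).
  have [e1 e2] : i - 1 - 1 = i - 2 /\ i - 1 - 2 + 2 = i - 2 + 1 by lia.
  (* Across the row of zeros the three values are 1, 0, -1, which satisfy the recurrence for any
     coefficient. *)
  rewrite e lattice_one e1 lattice_zero mulr0 sub0r lattice_antisym e2 opprK.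
  have := lattice_one (i - 1); rewrite e1 => <-.
  by congr (L _ _); lia.
have [ge|lt] := lerP 0 (j - i).
  have {}hij := hij ltac:(lia).
  rewrite !lattice_array ?(frieze_rec_right ge hij) //;
    by apply: (in_array_sub hij); lia.
have {}hji := hji ltac:(lia).
(* The mirror turns the three entries into [m (j + 2)], [m (j + 1)] and [m j] at [i - 2], up to
   sign; the coefficient is still [a j]. *)
have := @frieze_rec_left j (i - 2) ltac:(lia) hji.
rewrite !(lattice_antisym i) !lattice_array;
  try by apply: (in_array_sub hji); lia.
have [-> ->] : j - 1 + 2 = j + 1 /\ j - 2 + 2 = j by lia.
by move=> ->; ring.
Qed.

Lemma lattice_solves_rec (i : int) : solves_rec a (L i).
Proof.
move=> j; case sE: s => [|N].
  by apply: lattice_rec_near; rewrite sE /=; lia.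
have N3 : (3 <= N)%N by case: hfrieze => _ _ _; rewrite sE => -[].
(* Translations by [N] change [j - i] by [2 * N]. This window has [2 * N - 1] values, so one residue
   is missing: [N - 1], where the second row of zeros is crossed. *)
have near (k l : int) : - N%:Z <= l - k <= N%:Z - 2 ->
    L k l = a l * L k (l - 1) - L k (l - 2).
  by move=> h; apply: lattice_rec_near; rewrite sE /=; lia.
have [d] : exists d : nat, (`|j - i| <= d)%N by exists `|j - i|%N.
elim: d i j => [|d IH] i j hd.
  by apply: near; lia.
have shift k : L i k = L (i + N%:Z) (k - N%:Z).
  by rewrite -(finite_lattice_shift (i + N%:Z) _ sE) addrK subrK.
have [e|ne] := eqVneq (j - i) (N%:Z - 1).
  case: hfrieze => _ _ _; rewrite sE => -[_ mN1 mN0].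
  have -> : L i j = -1.
    rewrite shift lattice_antisym lattice_array ?sE /=; last by lia.
    by rewrite -(mN1 (i + 1)); congr (- m _ _); lia.
  have -> : L i (j - 1) = 0.
    by rewrite lattice_array ?sE /= -?(mN0 i); [congr (m _ _) | ]; lia.
  have -> : L i (j - 2) = 1.
    by rewrite lattice_array ?sE /= -?(mN1 i); [congr (m _ _) | ]; lia.
  by rewrite mulr0 sub0r.
have [ge|lt] := lerP N%:Z (j - i).
  have aE : a j = a (j - N%:Z).
    by rewrite -(finite_quiddity_periodic (j - N%:Z) sE) subrK.
  have -> : L i j = a j * L (i + N%:Z) (j - N%:Z - 1) - L (i + N%:Z) (j - N%:Z - 2).
    (* At [j - i = N] the translation does not decrease [|j - i|], but it lands in the window of
       [near]. *)
    rewrite shift aE; have [e|ne'] := eqVneq (j - i) N%:Z.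
      by apply: near; lia.
    by apply: IH; lia.
  by rewrite !shift; congr (_ * L _ _ - L _ _); lia.
have [ge'|lt'] := lerP (- N%:Z) (j - i); first by apply: near; lia.
have shift' k : L i k = L (i - N%:Z) (k + N%:Z).
  by rewrite (finite_lattice_shift _ _ sE).
rewrite !shift' (IH (i - N%:Z) (j + N%:Z)) ?(finite_quiddity_periodic _ sE);
  last by lia.
by congr (_ * L _ _ - L _ _); lia.
Qed.

End Frieze.

Theorem theorem2p5 (R : realType) (s : frieze_shape) (n : nat)
    (m L : int -> int -> R) (q : n.-tuple R) (hn : (1 <= n)%N)
    (hfrieze : is_frieze s m) (htame : tame s m) (hper : periodic s n m)
    (hq : quiddity_sequence m q) (hL : is_lattice s m L) :
  let s_q := L 1 n%:Z - L 2 (n%:Z - 1) in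
  (forall i j : int, L i (j + 2 * n%:Z) = s_q * L i (j + n%:Z) - L i j) /\
  (forall i j : int, L (i - 2 * n%:Z) j = s_q * L (i - n%:Z) j - L i j).
Proof.
move=> s_q; pose a i := m i i.
have aper (j : int) : a (j + n%:Z) = a j.
  by apply: hper (in_array_diag hfrieze j).
have hrec i : solves_rec a (L i).
  by move=> j; apply: (lattice_solves_rec hfrieze htame hL).
have L0 (i j : int) : j = i - 2 -> L i j = 0.
  by move=> ->; apply: (lattice_zero hfrieze hL).
have L1 (i j : int) : j = i - 1 -> L i j = 1.
  by move=> ->; apply: (lattice_one hfrieze hL).
have anti : forall i j, L i j = - L (j + 2) (i - 2).
  exact: (lattice_antisym hfrieze hL).
have right i j : L i (j + 2 * n%:Z) = s_q * L i (j + n%:Z) - L i j.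
  apply: (solves_rec_monodromy (hrec 1) (hrec 2)) => //;
    [exact: L1 | exact: L0 | exact: L0 | by rewrite anti L1].
split=> // i j.
(* The first identity is symmetric in its two outer terms, so after mirroring it is solved for the
   term at [i - 2 - 2 * n]. *)
rewrite !(anti _ j) -(subrK (2 * n%:Z) (i - 2)) right.
have -> : i - 2 - 2 * n%:Z + n%:Z = i - n%:Z - 2 by lia.
have -> : i - 2 * n%:Z - 2 = i - 2 - 2 * n%:Z by lia.
ring.
Qed.
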